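(* Let $(\alpha_1,\ldots,\alpha_n,\tau)$ be a nondegenerate compatible tuple on $V$, let $K=\ker(\tau)$ and $U=V\setminus K$, and assume that there exist $i,j\in\{1,\ldots,n\}$ such that $\alpha_i(U)\subseteq U$ and $\alpha_j(U)\subseteq K$. Then $\alpha_j(x)=0$ for all $x\in V$.
   Context: $\mathbb{K}$ is a field of characteristic $0$, $V$ is a vector space over $\mathbb{K}$, and $n$ is a positive integer. Let $\alpha_1,\ldots,\alpha_n:V\to V$ and $\tau:V\to\mathbb{K}$ be linear maps. The tuple $(\alpha_1,\ldots,\alpha_n,\tau)$ is called compatible on $V$ if $$\tau(\alpha_i(x))\,\tau(y)=\tau(x)\,\tau(\alpha_i(y))\quad\text{and}\quad \tau(\alpha_i(x))\,\alpha_j(y)=\tau(\alpha_j(y))\,\alpha_i(x)$$ for all $x,y\in V$ and all $i,j\in\{1,\ldots,n\}$. A compatible tuple is nondegenerate if $\ker(\tau)\neq V$ and $\ker(\tau)\neq\{0\}$. Here $V\setminus K$ denotes the set-theoretic complement. *)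

(* Defs.v *)
From HB Require Import structures.
From mathcomp Require Import all_boot all_order all_algebra.
From mathcomp Require Import classical_sets.

Set Implicit Arguments.
Unset Strict Implicit.
Unset Printing Implicit Defensive.

Import GRing.Theory.
Local Open Scope ring_scope.
Local Open Scope classical_set_scope.

(* Stated for an arbitrary left module, since [V] may be infinite-dimensional
   ([lker] from the vector library only covers finite dimension). *)
Definition ker (F : fieldType) (V : lmodType F) (tau : {linear V -> F^o}) :
  set V := [set x | tau x = 0].

Definition compatible (F : fieldType) (V : lmodType F) (n : nat)
    (alpha : 'I_n -> {linear V -> V}) (tau : {linear V -> F^o}) : Prop :=
  forall (x y : V) (i j : 'I_n),
    tau (alpha i x) * tau y = tau x * tau (alpha i y) /\
    (tau (alpha i x) : F) *: alpha j y = (tau (alpha j y) : F) *: alpha i x.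

Definition nondegenerate_compatible (F : fieldType) (V : lmodType F) (n : nat)
    (alpha : 'I_n -> {linear V -> V}) (tau : {linear V -> F^o}) : Prop :=
  [/\ compatible alpha tau, ker tau <> [set: V] & ker tau <> [set 0]].

(* Main.v *)
Require Import Defs.
From HB Require Import structures.
From mathcomp Require Import all_boot all_order all_algebra.
From mathcomp Require Import classical_sets.

Set Implicit Arguments.
Unset Strict Implicit.
Unset Printing Implicit Defensive.

Import GRing.Theory.
Local Open Scope ring_scope.
Local Open Scope classical_set_scope.

(** Fix a vector [u] outside [ker tau].  The first compatibility identity makes
    [tau \o a] proportional to [tau] for each map [a] of the tuple, so the value
    at [u] decides everything: [alpha j u] lies in [ker tau], hence
    [tau \o alpha j] vanishes identically.  The second identity, for [alpha i] at
    [u] and [alpha j] at [x], then reads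
    [tau (alpha i u) *: alpha j x = 0], and the scalar is nonzero because
    [alpha i u] stays outside [ker tau]. *)

Theorem proposition4p5 (F : fieldType) (char0 : [pchar F] =i pred0)
    (V : lmodType F) (n : nat) (n_gt0 : (0 < n)%N)
    (alpha : 'I_n -> {linear V -> V}) (tau : {linear V -> F^o})
    (alpha_tau : nondegenerate_compatible alpha tau)
    (i j : 'I_n)
    (alpha_i_U : alpha i @` (~` ker tau) `<=` ~` ker tau)
    (alpha_j_U : alpha j @` (~` ker tau) `<=` ker tau) :
  forall x : V, alpha j x = 0.
Proof.
case: alpha_tau => compat kerNT _ x.
have /setTPn [u uU] : ker tau != [set: V] by apply/eqP.
have tau_u : (tau u : F) != 0 by apply/eqP.
have tau_iu : (tau (alpha i u) : F) != 0.
  by apply/eqP; apply: alpha_i_U; exists u.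
have tau_ju : tau (alpha j u) = 0 by apply: alpha_j_U; exists u.
have tau_jx : tau (alpha j x) = 0.
  have [/eqP + _] := compat x u j j.
  by rewrite tau_ju mulr0 mulf_eq0 (negPf tau_u) orbF => /eqP.
have [_ /eqP] := compat u x i j.
by rewrite tau_jx scale0r scaler_eq0 (negPf tau_iu) => /eqP.
Qed.
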